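(* Let $R$ be a commutative ring with identity, $I$ an ideal of $R$, $M$ an $R$-module, and $F$ a proper submodule of $M$ such that $IM\subseteq F$. If $I(+)F$ is a 2-absorbing ideal of the ring $R(+)M$, then $I$ is a 2-absorbing ideal of $R$.
   Context: All rings are commutative with identity and all modules are unital. The idealization (trivial extension) of $R$ by $M$, denoted $R(+)M$ or $R\propto M$, is the set $\{(r,m): r\in R,\ m\in M\}$ with componentwise addition and multiplication $(r_1,m_1)\cdot(r_2,m_2)=(r_1r_2,\,r_1m_2+r_2m_1)$; it is a commutative ring with identity $(1,0)$. For an ideal $I$ of $R$ and a submodule $F$ of $M$, $I(+)F=\{(r,m): r\in I,\ m\in F\}$; it is an ideal of $R(+)M$ exactly when $IM\subseteq F$. A nonzero proper ideal $I$ of a ring $R$ is called 2-absorbing if whenever $a,b,c\in R$ and $abc\in I$, then $ab\in I$ or $ac\in I$ or $bc\in I$.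
   Formalization: Since 2-absorbing ideals are nonzero by definition, the claim fails for I = 0 (R a field K, M = K², F = K×0); the theorem shows I is proper and absorbing always, and 2-absorbing when I is nonzero. Subsets have decidable membership (classically all). *)

(* Defs.v *)
From HB Require Import structures.
From mathcomp Require Import all_boot all_algebra.

Set Implicit Arguments.
Unset Strict Implicit.
Unset Printing Implicit Defensive.

Import GRing.Theory.
Local Open Scope ring_scope.

(* Rings are [comPzRingType]s, so the zero ring is allowed, and subsets are
   boolean predicates [{pred _}], as in [GRing.submod_closed]. *)

(* The alias keeps the ring structure below apart from the componentwise one
   that products of rings carry. *)
Definition idealization (R : comPzRingType) (M : lmodType R) : Type :=
  (R * M)%type.

Section IdealizationRing.
Variables (R : comPzRingType) (M : lmodType R).
Local Notation RM := (idealization M).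

HB.instance Definition _ := GRing.Zmodule.copy RM (R * M)%type.

Definition idealization_one : RM := (1, 0).
Definition idealization_mul (x y : RM) : RM :=
  (x.1 * y.1, x.1 *: y.2 + y.1 *: x.2).

Fact idealization_mulA : associative idealization_mul.
Proof.
move=> [a m] [b n] [c p]; congr (_, _) => /=; first exact: mulrA.
by rewrite !scalerDr !scalerA addrA (mulrC c a) (mulrC c b).
Qed.

Fact idealization_mulC : commutative idealization_mul.
Proof. by move=> [a m] [b n]; congr (_, _) => /=; rewrite (mulrC, addrC). Qed.

Fact idealization_mul1 : left_id idealization_one idealization_mul.
Proof.
by move=> [a m]; congr (_, _) => /=; rewrite ?mul1r ?scale1r ?scaler0 ?addr0.
Qed.

Fact idealization_mulDl : left_distributive idealization_mul +%R.
Proof.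
move=> [a m] [b n] [c p]; congr (_, _) => /=; first exact: mulrDl.
by rewrite scalerDl scalerDr addrACA.
Qed.

HB.instance Definition _ := GRing.Zmodule_isComPzRing.Build RM
  idealization_mulA idealization_mulC idealization_mul1 idealization_mulDl.

End IdealizationRing.

Definition idealization_set (R : comPzRingType) (M : lmodType R)
    (I : {pred R}) (F : {pred M}) : {pred idealization M} :=
  [pred x : idealization M | (x.1 \in I) && (x.2 \in F)].

Definition nonzero_subset (V : zmodType) (S : {pred V}) : Prop :=
  exists2 x, x \in S & x != 0.

Definition proper_subset (T : Type) (S : {pred T}) : Prop :=
  exists x, x \notin S.

(* [idealr_closed] of MathComp is not used: it forces ideals to be proper. *)
Definition is_ideal (R : comPzRingType) (I : {pred R}) : Prop :=
  GRing.submod_closed (I : {pred R^o}).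

Definition absorbs2 (R : comPzRingType) (I : {pred R}) : Prop :=
  forall a b c : R, a * b * c \in I ->
    [\/ a * b \in I, a * c \in I | b * c \in I].

Definition two_absorbing (R : comPzRingType) (I : {pred R}) : Prop :=
  [/\ is_ideal I, nonzero_subset I, proper_subset I & absorbs2 I].

Lemma idealization_set_idealP (R : comPzRingType) (M : lmodType R)
    (I : {pred R}) (F : {pred M}) :
  is_ideal I -> GRing.submod_closed F ->
  is_ideal (idealization_set I F) <->
  (forall a m, a \in I -> a *: m \in F).
Proof.
move=> [I0 Il] [F0 Fl]; split=> [[_ IFl] a m aI | IMF].
  have x0 : (0 : idealization M) \in idealization_set I F.
    by rewrite inE I0 F0.
  have aIF : ((a, 0) : idealization M) \in idealization_set I F.
    by rewrite inE aI F0.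
  have := IFl ((0, m) : idealization M) _ _ aIF x0.
  by rewrite addr0 => /andP[_] /=; rewrite scale0r add0r.
split=> [|[a m] [r p] [s q]]; first by rewrite inE I0 F0.
rewrite !inE /= => /andP[rI pF] /andP[sI qF].
rewrite (Il a) //= -addrA; apply: (Fl a) => //.
by rewrite -(scale1r (r *: m)); apply: (Fl 1) => //; apply: IMF.
Qed.

(* A nonzero [I (+) F] may have [I] zero, which is never 2-absorbing by the
   definition above: take for [M] a plane over a field and for [F] a line. *)
Lemma two_absorbing_idealization_zero (K : fieldType) :
  exists F : {pred (K^o * K^o)%type},
  [/\ GRing.submod_closed F, proper_subset F,
      two_absorbing (idealization_set (pred1 (0 : K)) F)
    & ~ two_absorbing (pred1 (0 : K))].
Proof.
pose F : {pred (K^o * K^o)%type} := [pred u | u.2 == 0].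
have subF : GRing.submod_closed F.
  split=> [|a [x y] [z t]]; first by rewrite inE.
  by rewrite !inE /= => /eqP-> /eqP->; rewrite scaler0 addr0.
exists F; split=> //; first by exists (0, 1); rewrite inE oner_eq0.
  split.
  - apply/idealization_set_idealP => //.
      split=> [|a x y]; rewrite ?inE //.
      by move=> /eqP-> /eqP->; rewrite scaler0 addr0.
    by move=> a m /eqP->; rewrite scale0r inE.
  - exists (0, (1, 0)); first by rewrite !inE /= !eqxx.
    by apply/negP => /eqP[] /eqP; rewrite oner_eq0.
  - by exists (1, 0); rewrite inE /= inE oner_eq0.
  - move=> [a [a1 a2]] [b [b1 b2]] [c [c1 c2]].
    rewrite !inE /= /GRing.scale /=.
    case: (eqVneq a 0) => [->|a0]; case: (eqVneq b 0) => [->|b0];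
      case: (eqVneq c 0) => [->|c0];
      rewrite ?(mul0r, mulr0, addr0, add0r, eqxx) /=;
      rewrite ?mulf_eq0 ?(negbTE a0) ?(negbTE b0) ?(negbTE c0) /= => h;
      by [constructor 1|constructor 2|constructor 3|].
by case=> _ [x /eqP-> /eqP].
Qed.

(* Main.v *)
Require Import Defs.
From HB Require Import structures.
From mathcomp Require Import all_boot all_algebra.
Import GRing.Theory.
Local Open Scope ring_scope.

(** The map [a |-> (a, 0)] is a ring morphism from [R] to the idealization of
    [M], and the preimage of [I (+) F] under it is [I], because [0] lies in [F].
    The absorbing condition only concerns products, so it passes to preimages
    under this map.  Properness of [I] comes from that of [F]: if [1] were in
    [I], then [F] would contain [1 *: m = m] for every [m]. *)

Lemma mem_idealization_set0 (R : comPzRingType) (M : lmodType R)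
    (I : {pred R}) (F : {pred M}) (a : R) :
  0 \in F -> (((a, 0) : idealization M) \in idealization_set I F) = (a \in I).
Proof. by move=> F0; rewrite inE /= F0 andbT. Qed.

Lemma idealization_mul0 (R : comPzRingType) (M : lmodType R) (a b : R) :
  ((a, 0) : idealization M) * ((b, 0) : idealization M) = (a * b, 0).
Proof. by congr (_, _); rewrite /= !scaler0 addr0. Qed.

Lemma absorbs2_idealization_set (R : comPzRingType) (M : lmodType R)
    (I : {pred R}) (F : {pred M}) :
  0 \in F -> absorbs2 (idealization_set I F) -> absorbs2 I.
Proof.
move=> F0 absIF a b c abcI.
have := absIF ((a, 0) : idealization M) (b, 0) (c, 0).
by rewrite !idealization_mul0 !mem_idealization_set0 //; apply.
Qed.

Lemma proper_subset_scaler (R : comPzRingType) (M : lmodType R)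
    (I : {pred R}) (F : {pred M}) :
  (forall (a : R) (m : M), a \in I -> a *: m \in F) ->
  proper_subset F -> proper_subset I.
Proof.
move=> IMF [m mF]; exists 1; apply: contra mF => I1.
by rewrite -(scale1r m); apply: IMF.
Qed.

Theorem proposition2p6 (R : comPzRingType) (I : {pred R}) (M : lmodType R)
    (F : {pred M}) (I_ideal : is_ideal I) (F_submod : GRing.submod_closed F)
    (F_proper : proper_subset F)
    (IM_sub_F : forall (a : R) (m : M), a \in I -> a *: m \in F)
    (IF_2abs : two_absorbing (idealization_set I F)) :
  [/\ proper_subset I, absorbs2 I & nonzero_subset I -> two_absorbing I].
Proof.
have I_proper : proper_subset I by apply: proper_subset_scaler IM_sub_F F_proper.
have I_abs : absorbs2 I.
  by case: F_submod IF_2abs => F0 _ [_ _ _]; apply: absorbs2_idealization_set.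
by split=> // I_nz; split.
Qed.
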